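(* Let $k\ge 1$, let $\alpha_0,\alpha_1,\ldots,\alpha_{k-1}$ be countably infinite order types, and let $x_0,\ldots,x_{k-1}$ be irrational numbers such that $1,x_0,x_1,\ldots,x_{k-1}$ are linearly independent over $\mathbb{Q}$. Then: (1) There is a set $A\subseteq\mathbb{N}$ such that $x_i \ast A \simeq \alpha_i$ for every $i\in\{0,1,\ldots,k-1\}$. (2) Moreover, for any function $\Psi:\mathbb{N}\to\mathbb{N}$ with $\Psi(n)\to\infty$, the set $A$ in (1) can be chosen so that additionally $|A\cap[0,n)|\le \Psi(n)$ for all $n\in\mathbb{N}$. (3) If every $\alpha_i$ is an ordinal (i.e. the order type of a well-ordered set), then every set $A\subseteq\mathbb{N}$ with $x_i\ast A\simeq\alpha_i$ for all $i$ has natural density $0$; but for any function $\Theta:\mathbb{N}\to\mathbb{N}$ with $\Theta(n)/n\to 0$, the set $A$ in (1) can be chosen so that additionally $|A\cap[0,n)|>\Theta(n)$ for infinitely many $n\in\mathbb{N}$.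
   Context: For a real number $x$ and a set $A\subseteq\mathbb{N}$, define $x\ast A := \{xa \bmod 1 : a\in A\}\subseteq[0,1)$, ordered as a subset of the reals. For a linearly ordered set $X$ and an order type $\alpha$, $X\simeq\alpha$ means $X$ has order type $\alpha$. The natural density of $A$ is $\lim_{n\to\infty}|A\cap[0,n)|/n$ when it exists. *)

(* Defs.v *)
From HB Require Import structures.
From mathcomp Require Import all_boot all_order all_algebra finmap.
From mathcomp Require Import all_classical all_reals all_analysis.

Set Implicit Arguments.
Unset Strict Implicit.
Unset Printing Implicit Defensive.

Import Order.TTheory GRing.Theory Num.Theory.
Import numFieldNormedType.Exports.

Local Open Scope classical_set_scope.
Local Open Scope ring_scope.

Definition frac_part (R : realType) (y : R) : R := y - (Num.floor y)%:~R.

Definition star (R : realType) (x : R) (A : set nat) : set R :=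
  [set frac_part (x * a%:R) | a in A].

(* An order type is represented by a linear order T having that type: X has
   order type T when X, with the order of the reals, is isomorphic to T. *)
Definition has_order_type (R : realType) (X : set R)
    (d : Order.disp_t) (T : orderType d) : Prop :=
  exists f : T -> R,
    set_bij [set: T] X f /\ forall s t : T, (f s <= f t) = (s <= t)%O.

Definition lin_indep_rat (R : realType) (I : finType) (v : I -> R) : Prop :=
  forall c : I -> rat, \sum_i ratr (c i) * v i = 0 -> forall i, c i = 0.

(* `I_n is the initial segment [0, n) of nat. *)
Definition count_below (A : set nat) (n : nat) : nat :=
  #|` fset_set (A `&` `I_n)|%N.

Definition has_natural_density (R : realType) (A : set nat) (l : R) : Prop :=
  (count_below A n)%:R / n%:R @[n --> \oo] --> l.

(* Main.v *)
Require Import Defs.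
From HB Require Import structures.
From mathcomp Require Import all_boot all_order all_algebra finmap.
From mathcomp Require Import all_classical all_reals all_analysis.
From mathcomp Require Import ring lra zify.

(* By Kronecker's theorem the simultaneous fractional parts of the a x_i meet
   every box of the torus with bounded gaps.  A set A realising the given order
   types is then built in finite stages, by adding an integer whose fractional
   parts fall into prescribed gaps between the points already placed; it can be
   taken as large as desired, which makes A sparse.  To make A occasionally
   dense, one notes that finitely many placed points leave for each i a gap of
   alpha_i with infinitely many elements, so that all integers below n whose
   fractional parts lie in the corresponding box, a number of them linear in n,
   can be added at once.  That A has density 0 when some alpha_i is well ordered
   comes from a supremum argument, since x_i * A has a gap to the right of each
   real and the integers a with a x_i mod 1 in a short interval are far apart. *)

Set Implicit Arguments.
Unset Strict Implicit.
Unset Printing Implicit Defensive.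

Import Order.TTheory GRing.Theory Num.Theory.
Import numFieldNormedType.Exports.

Local Open Scope classical_set_scope.
Local Open Scope ring_scope.

(** * Fractional parts and simultaneous Diophantine approximation *)

Lemma frac_part_ge0 (R : realType) (y : R) : 0 <= frac_part y.
Proof. by have /andP[h _] := floor_itv y; rewrite /frac_part subr_ge0. Qed.

Lemma frac_part_lt1 (R : realType) (y : R) : frac_part y < 1.
Proof.
have /andP[_ h] := floor_itv y.
by rewrite /frac_part ltrBlDl -[1]/(1%:~R) -intrD.
Qed.

Lemma frac_part_eq (R : realType) (y : R) (z : int) :
  0 <= y - z%:~R < 1 -> frac_part y = y - z%:~R.
Proof.
move=> /andP[h0 h1]; rewrite /frac_part (@floor_def _ y z) // intrD.
by apply/andP; split; lra.
Qed.

Lemma grid_cell (R : realType) (q : nat) (w : R) : 0 <= w < 1 ->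
  exists c : 'I_q.+1, c%:R / q.+1%:R <= w < (c%:R + 1) / q.+1%:R.
Proof.
move=> /andP[w0 w1].
have q0 : 0 < q.+1%:R :> R by rewrite ltr0n.
have /andP[h1 h2] := floor_itv (w * q.+1%:R).
have fl0 : 0 <= Num.floor (w * q.+1%:R) by rewrite floor_ge0 mulr_ge0 // ltW.
case E : (Num.floor (w * q.+1%:R)) fl0 h1 h2 => [c|//] _ h1 h2.
have hc : (c < q.+1)%N.
  rewrite -(ltr_nat R); apply: (le_lt_trans h1).
  by rewrite gtr_pMl.
exists (Ordinal hc); rewrite ler_pdivrMr // ltr_pdivlMr //.
by rewrite h1 /=; rewrite intrD in h2.
Qed.

(** Pigeonhole: among the fractional-part vectors for [(q+1)^k + 1] values of [n], two share one of
    the [(q+1)^k] grid cells, and [s] is the difference of their indices. *)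
Lemma dirichlet (R : realType) (k : nat) (x : 'I_k -> R) (q : nat) :
  exists s : nat, (0 < s)%N /\ exists g : 'I_k -> int,
    forall i, `|s%:R * x i - (g i)%:~R| < q.+1%:R^-1.
Proof.
have [f fP] := choice (fun p : 'I_(q.+1 ^ k).+1 * 'I_k =>
  @grid_cell R q (frac_part (p.1%:R * x p.2))
    (introT andP (conj (frac_part_ge0 _) (frac_part_lt1 _)))).
pose F n : {ffun 'I_k -> 'I_q.+1} := [ffun i => f (n, i)].
have /injectivePn[n [m nm Fnm]] : ~~ injectiveb F.
  apply/negP => /injectiveP /leq_card.
  by rewrite card_ffun !card_ord ltnn.
wlog ltnm : n m nm Fnm / (n < m)%N.
  move=> H; case: (ltngtP n m) => [h|h|/ord_inj h].
  - exact: (H n m).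
  - by apply: (H m n) => //; rewrite eq_sym.
  - by rewrite h eqxx in nm.
exists (m - n)%N; split; first by rewrite subn_gt0.
exists (fun i => Num.floor (m%:R * x i) - Num.floor (n%:R * x i)) => i.
have := fP (n, i); have := fP (m, i) => /=.
have -> : f (n, i) = f (m, i) by move/ffunP: Fnm => /(_ i); rewrite !ffunE.
rewrite /frac_part natrB 1?ltnW // intrD mulrNz !mulrDl !mul1r mulNr.
move: q.+1%:R^-1 (Num.floor _)%:~R (Num.floor _)%:~R => Q fm fn.
by move=> /andP[a1 a2] /andP[b1 b2]; rewrite ltr_norml; apply/andP; split; lra.
Qed.

(** Rational independence of 1 and the [v i] with denominators cleared; [c0] is the coefficient of
    1, whose vanishing follows once all [c i] are 0. *)
Definition int_indep (R : realType) (I : finType) (v : I -> R) : Prop :=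
  forall (c0 : int) (c : I -> int),
    c0%:~R + \sum_i (c i)%:~R * v i = 0 -> forall i, c i = 0.

Lemma lin_indep_rat_int (R : realType) (I : finType) (v : I -> R) :
  lin_indep_rat (oapp v 1) -> int_indep v.
Proof.
move=> h c0 c hc i.
pose c' (o : option I) : rat := if o is Some j then (c j)%:~R else c0%:~R.
have /(h c')/(_ (Some i)) : \sum_o ratr (c' o) * oapp v 1 o = 0 :> R.
  rewrite -[RHS]hc (bigD1 None) //= mulr1 ratr_int; congr (_ + _).
  rewrite (reindex_omap (Some : I -> option I) id) /=; last by case.
  by apply: eq_big => [j|j _]; rewrite ?eqxx // ratr_int.
by move/eqP; rewrite /= intr_eq0 => /eqP.
Qed.

(* Estermann's proof: take a simultaneous approximation s with small errors
   phi i = s x_i - g_i; the ratios phi i / phi 0 are again independent, so by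
   induction some c0 moves them close to a prescribed point, and then a
   multiple t s, with t close to (c0 + a 0) / phi 0, does the job. *)
Lemma kronecker (R : realType) (k : nat) (x a : 'I_k -> R) (e : R) :
  int_indep x -> 0 < e ->
  exists n : int, exists g : 'I_k -> int,
    forall i, `|n%:~R * x i - (g i)%:~R - a i| < e.
Proof.
elim: k x a e => [|k IH] x a e indx e0; first by exists 0, (fun=> 0) => -[].
have [q qe] : exists q : nat, q.+1%:R^-1 < e / 2.
  exists (Num.truncn (e / 2)^-1); rewrite invf_plt ?posrE ?ltr0n ?divr_gt0 //.
  by apply: truncnS_gt.
have [s [s0 [g hg]]] := dirichlet x q.
pose phi i := s%:R * x i - (g i)%:~R.
have phi_small i : `|phi i| < e / 2 by apply: lt_trans (hg i) qe.
(* An integer relation among the [phi i] is one among 1 and the [x i], with the coefficients of the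
   latter multiplied by [s > 0]. *)
have phi_rel (c : 'I_k.+1 -> int) : \sum_i (c i)%:~R * phi i = 0 ->
    forall i, c i = 0.
  move=> hc i.
  have : c i * s = 0.
    apply: (indx (- \sum_i c i * g i) (fun i => c i * s)).
    rewrite -[RHS]hc mulrNz rmorph_sum /= addrC -sumrB; apply: eq_bigr => j _.
    by rewrite /phi !rmorphM /= pmulrn; ring.
  by move/eqP; rewrite mulf_eq0 => /orP[/eqP//|/eqP[sE]]; rewrite sE in s0.
have phi0 : phi ord0 != 0.
  apply/eqP => h.
  suff /phi_rel/(_ ord0) : \sum_i ((i == ord0)%:Z)%:~R * phi i = 0.
    by rewrite eqxx.
  rewrite big_ord_recl h mulr0 add0r big1 // => j _.
  by rewrite eq_sym (negbTE (neq_lift _ _)) mul0r.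
pose y i := phi (lift ord0 i) / phi ord0.
have indy : int_indep y.
  move=> c0 c hc i.
  pose c' j := if unlift ord0 j is Some i then c i else c0.
  have -> : c i = c' (lift ord0 i) by rewrite /c' liftK.
  apply: phi_rel; rewrite big_ord_recl.
  rewrite -[RHS](mul0r (phi ord0)) -[X in _ = X * _]hc mulrDl mulr_suml /c' unlift_none.
  congr (_ + _); apply: eq_bigr => j _.
  by rewrite liftK /y mulrA mulfVK.
have [c0 [c hc]] := IH y (fun i => a (lift ord0 i) - a ord0 * y i) (e / 2) indy
  ltac:(lra).
pose u := (c0%:~R + a ord0) / phi ord0.
(* Rounding [u] to an integer moves each coordinate by at most [|phi i|], below [e / 2]; the other
   half is left for the inductive approximation. *)
pose t := Num.floor u.
have ht : `|t%:~R - u| <= 1.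
  have := floor_itv u; rewrite -/t intrD => /andP[h1 h2].
  by rewrite ler_norml; apply/andP; split; lra.
have small i : `|(t%:~R - u) * phi i| < e / 2.
  rewrite normrM; apply: le_lt_trans (phi_small i).
  by rewrite ler_piMl.
exists (t * s), (fun j => t * g j +
  (if unlift ord0 j is Some i then c i else c0)) => j.
have -> z : (t * s)%:~R * x j - (t * g j + z)%:~R - a j
    = t%:~R * phi j - z%:~R - a j.
  by rewrite intrD !intrM /phi pmulrn; ring.
have [i ->|->] := unliftP ord0 j.
  rewrite -[X in `|X|](_ : (t%:~R - u) * phi (lift ord0 i) +
    (c0%:~R * y i - (c i)%:~R - (a (lift ord0 i) - a ord0 * y i)) = _); last first.
    by rewrite /u /y; field.
  by apply: le_lt_trans (ler_normD _ _) _; have := small (lift ord0 i); have := hc i; lra.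
rewrite -[X in `|X|](_ : (t%:~R - u) * phi ord0 = _).
  by apply: lt_trans (small _) _; lra.
by rewrite /u; field.
Qed.

(** Kronecker gives one integer shift [h c] per corner of a finite grid, so the shifts are bounded
    by some [H]. From any [b], the shift for the cell of the displacement to the box centre leads
    into the box. *)
Lemma syndetic_hits (R : realType) (k : nat) (x lo hi : 'I_k -> R) :
  int_indep x -> (forall i, [/\ 0 <= lo i, lo i < hi i & hi i <= 1]) ->
  exists L : nat, (0 < L)%N /\ forall N, exists a, (N <= a < N + L)%N /\
    forall i, lo i < frac_part (x i * a%:R) < hi i.
Proof.
move=> indx box.
(* The grid cell and the Kronecker error each cost less than one mesh width, together less than half
   the side of the box. *)
have [q hq] : exists q : nat, forall i, 4 * q.+1%:R^-1 < hi i - lo i.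
  exists (\max_i Num.truncn (4 / (hi i - lo i))) => i.
  have [_ lthi _] := box i; rewrite -subr_gt0 in lthi.
  rewrite ltr_pdivrMr ?ltr0n // mulrC -ltr_pdivrMr //.
  apply: lt_le_trans (truncnS_gt _) _.
  by rewrite ler_nat ltnS (leq_bigmax i).
have q0 : 0 < q.+1%:R^-1 :> R by rewrite invr_gt0 ltr0n.
have [h hP] := choice (fun c : {ffun 'I_k -> 'I_q.+1} =>
  kronecker (fun i => (c i)%:R / q.+1%:R) indx q0).
pose H := (\max_c `|h c|)%N.
have hH c : (`|h c| <= H)%N by apply: leq_bigmax.
exists (2 * H).+1; split=> // N.
(* Shifts may be negative; starting at [N + H] keeps [a] within [[N, N + 2H]]. *)
pose b := (N + H)%N.
pose w i := (lo i + hi i) / 2 - frac_part (x i * b%:R).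
have [c cP] := choice (fun i => @grid_cell R q (frac_part (w i))
  (introT andP (conj (frac_part_ge0 _) (frac_part_lt1 _)))).
pose c' := [ffun i => c i]; have [g gP] := hP c'.
have hb : (`|h c'| <= H)%N by [].
have [a ab] : exists a : nat, a = (b%:Z + h c')%R :> int.
  by exists `|(b%:Z + h c')%R|%N; rewrite gez0_abs // /b; lia.
exists a; split; first by rewrite /b in ab; lia.
move=> i; have [lo0 lohi hi1] := box i.
have := gP i; have := cP i; have := hq i; rewrite ffunE.
have -> : a%:R = b%:R + (h c')%:~R :> R by rewrite !pmulrn ab intrD.
move: q0; rewrite mulrDl mul1r.
have wE := erefl (w i); rewrite {2}/w /frac_part in wE.
rewrite {1 2}/frac_part mulrDr (mulrC (x i) (h c')%:~R).
set fb := Num.floor _ in wE; set fw := Num.floor _.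
rewrite ltr_norml.
move: q.+1%:R^-1 => Q Q0 Q4 /andP[c1 c2] /andP[e1 e2].
rewrite (@frac_part_eq _ _ (fb - fw + g i)) ?intrD ?mulrNz; apply/andP; split; lra.
Qed.

(** * Counting functions and sets with large gaps *)

Lemma count_belowE (A : set nat) (n : nat) :
  count_below A n = count (fun a => `[< A a >]) (iota 0 n).
Proof.
rewrite /count_below -size_filter; apply: perm_size; apply: uniq_perm.
- exact: fset_uniq.
- by rewrite filter_uniq ?iota_uniq.
move=> a; rewrite mem_filter mem_iota add0n /=.
rewrite in_fset_set; last by apply: finite_setIr; exact: finite_II.
by apply/idP/andP => [/set_mem[Aa an]|[/asboolP Aa an]];
  [split=> //; apply/asboolP | apply/mem_set; split].
Qed.

Lemma le_count_below (A B : set nat) (n : nat) :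
  A `<=` B -> (count_below A n <= count_below B n)%N.
Proof.
by move=> AB; rewrite !count_belowE; apply: sub_count => a /asboolP/AB/asboolP.
Qed.

Lemma count_belowU (A B : set nat) (n : nat) :
  (count_below (A `|` B) n <= count_below A n + count_below B n)%N.
Proof.
rewrite !count_belowE -count_predUI; apply: leq_trans (leq_addr _ _).
by apply: sub_count => a /asboolP[h|h] /=; apply/orP; [left|right]; apply/asboolP.
Qed.

(** The quotients by [M] of the elements below [n] are distinct and at most [n / M]. *)
Lemma count_below_spaced (A : set nat) (M n : nat) : (0 < M)%N ->
  (forall a b, A a -> A b -> (a < b)%N -> (a + M <= b)%N) ->
  (M * count_below A n <= n + M)%N.
Proof.
move=> M0 spaced; rewrite count_belowE -size_filter.
set s := seq.filter _ _.
suff h : (size s <= (n %/ M).+1)%N.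
  apply: leq_trans (leq_mul (leqnn M) h) _.
  by rewrite mulnS addnC leq_add2r mulnC leq_divM.
rewrite -(size_map (divn^~ M)) -(size_iota 0 (n %/ M).+1).
apply: uniq_leq_size.
  rewrite map_inj_in_uniq ?filter_uniq ?iota_uniq // => a b.
  rewrite !mem_filter => /andP[/asboolP Aa _] /andP[/asboolP Ab _] ab.
  have ha := divn_eq a M; have hb := divn_eq b M.
  have := ltn_pmod a M0; have := ltn_pmod b M0.
  by case: (ltngtP a b) => // [/(spaced _ _ Aa Ab)|/(spaced _ _ Ab Aa)];
    rewrite ab in ha; lia.
move=> _ /mapP[a + ->]; rewrite mem_filter mem_iota => /andP[_ /andP[_ an]].
by rewrite mem_iota /= add0n ltnS leq_div2r // ltnW.
Qed.

Lemma irrational_multiples_apart (R : realType) (x : R) (M : nat) :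
  irrational x ->
  exists e : R, 0 < e /\ forall (j : nat) (z : int), (0 < j < M)%N ->
    e <= `|x * j%:R - z%:~R|.
Proof.
move=> irrx; elim: M => [|M [e [e0 eP]]]; first by exists 1; split=> // j z; lia.
have [->|M0] := posnP M; first by exists 1; split=> // j z; lia.
have ne0 (z : int) : x * M%:R != z%:~R.
  apply/eqP => h; apply: irrx; exists (z%:Q / M%:Q) => //.
  rewrite fmorph_div /= !ratr_int -h -pmulrn mulfK //.
  by rewrite pnatr_eq0 -lt0n.
pose u := frac_part (x * M%:R).
have u0 : 0 < u.
  by rewrite lt_neqAle frac_part_ge0 andbT eq_sym subr_eq0.
have u1 : 0 < 1 - u by rewrite subr_gt0 frac_part_lt1.
exists (Num.min e (Num.min u (1 - u))); split; first by rewrite !lt_min e0 u0.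
move=> j z /andP[j0]; rewrite ltnS leq_eqVlt => /predU1P[->|jM]; last first.
  by rewrite ge_min eP // j0.
rewrite !ge_min; apply/orP; right.
have [h|h] := leP z (Num.floor (x * M%:R)).
  apply/orP; left; apply: le_trans (ler_norm _).
  by rewrite /u /frac_part lerB // ler_int.
apply/orP; right; rewrite distrC; apply: le_trans (ler_norm _).
have : (Num.floor (x * M%:R) + 1)%:~R <= z%:~R :> R by rewrite ler_int; lia.
by rewrite intrD /u /frac_part; lra.
Qed.

(** Two elements [a < b] at distance less than [M] would put [x * (b - a)] closer than [e] to an
    integer. *)
Lemma count_short_interval (R : realType) (x : R) (M : nat) : irrational x ->
  (0 < M)%N -> exists e : R, 0 < e /\ forall (y : R) (n : nat),
    (M * count_below [set a | (y - e <= frac_part (x * a%:R) < y)%R] n <= n + M)%N.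
Proof.
move=> irrx M0; have [e [e0 eP]] := irrational_multiples_apart M irrx.
exists e; split=> // y n; apply: count_below_spaced => // a b /= Aa Ab ab.
rewrite leqNgt; apply/negP => baM.
have := eP (b - a)%N
  (Num.floor (x * b%:R) - Num.floor (x * a%:R)) ltac:(lia).
rewrite leNgt => /negP; apply; rewrite natrB 1?ltnW // intrD mulrNz.
move: Aa Ab; rewrite /frac_part => /andP[a1 a2] /andP[b1 b2].
by rewrite mulrBr ltr_norml; apply/andP; split; lra.
Qed.

(** * Density zero for well-ordered images, and sublinear functions *)

Lemma well_order_right_gap (R : realType) (T : Type) (le : rel T) (f : T -> R)
    (s : R) : wochoice.well_order le -> (forall t u, (f t <= f u) = le t u) ->
  exists e : R, 0 < e /\ forall t, s < f t -> s + e <= f t.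
Proof.
move=> wo fle.
have [[t0 st0]|none] := pselect (exists t, s < f t); last first.
  by exists 1; split=> // t st; case: none; exists t.
have [|m [[sm mP] _]] := wo [pred t | s < f t]; first by exists t0.
exists (f m - s); split; first by rewrite subr_gt0.
by move=> t st; rewrite addrC subrK fle mP.
Qed.

(* The set of those y such that {a in A : frac (x a) < y} has density 0 is an
   initial segment which is closed under suprema, because short intervals
   contribute little density, and open to the right, because a well-ordered
   set of reals leaves a gap to the right of every real. *)
Lemma well_ordered_star_sparse (R : realType) (x : R) (A : set nat)
    (d : Order.disp_t) (T : orderType d) : irrational x ->
  has_order_type (star x A) T -> wochoice.well_order (<=%O : rel T) ->
  forall M : nat, exists C : nat, forall n,
    (M * count_below A n <= n + C)%N.
Proof.
move=> irrx [f [[fX _ fsurj] fle]] wo.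
pose B y := A `&` [set a | frac_part (x * a%:R) < y].
pose P y := forall M : nat, exists C : nat, forall n,
  (M * count_below (B y) n <= n + C)%N.
suff P1 : P 1.
  move=> M; have [C hC] := P1 M; exists C => n; apply: leq_trans (hC n).
  rewrite leq_mul2l le_count_below ?orbT // => a Aa; split=> //=.
  exact: frac_part_lt1.
have P0 : P 0.
  move=> M; exists 0%N => n; rewrite count_belowE (@eq_count _ _ pred0).
    by rewrite count_pred0 muln0.
  move=> a; apply/asboolP => -[_ /=].
  by rewrite ltNge frac_part_ge0.
pose E := [set y | P y /\ y <= 1].
have E0 : E 0 by split.
have supE : has_sup E by split; [exists 0 | exists 1 => y []].
pose s := sup E.
have s1 : s <= 1 by apply: sup_le_ub; [exists 0 | move=> y []].
have Ps : P s.
  case=> [|M]; first by exists 0%N.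
  (* With [2 * M.+1] for both pieces, [B y] and the short interval [[s - e, s)], their bounds add up
     to the one for [M.+1]. *)
  have [e [e0 eP]] := @count_short_interval R x (2 * M.+1) irrx isT.
  have [y [Py _] ys] := sup_adherent e0 supE.
  have [C hC] := Py (2 * M.+1)%N; exists (C + 2 * M.+1)%N => n.
  have := hC n; have := eP s n.
  have : (count_below (B s) n <= count_below (B y) n +
    count_below [set a | (s - e <= frac_part (x * a%:R) < s)%R] n)%N.
    apply: leq_trans (count_belowU _ _ _); apply: le_count_below.
    move=> a [Aa /= as_].
    have [h|h] := ltP (frac_part (x * a%:R)) y; [by left | right].
    by rewrite as_ andbT; apply: le_trans h; apply: ltW.
  by nia.
have [<-|slt1] := eqVneq s 1; first exact: Ps.
have [e [e0 eP]] := well_order_right_gap s wo fle.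
pose e' := Num.min e (1 - s).
have e'0 : 0 < e' by rewrite lt_min e0 subr_gt0 lt_neqAle slt1.
suff /(ub_le_sup (proj2 supE)) : E (s + e') by rewrite -/s; lra.
split; last first.
  by rewrite -lerBrDl /e' ge_min lexx orbT.
case=> [|M]; first by exists 0%N.
have [C hC] := Ps (2 * M.+1)%N; exists (C + 2 * M.+1)%N => n.
have [r [r0 rP]] := @count_short_interval R x (2 * M.+1) irrx isT.
have := hC n; have := rP (s + r)%R n.
(* No value lies strictly between [s] and [s + e'], so only the value [s] itself is new; the short
   interval [[s, s + r)] covers it. *)
have : (count_below (B (s + e')%R) n <= count_below (B s) n + count_below
    [set a | (s + r - r <= frac_part (x * a%:R) < s + r)%R] n)%N.
  apply: leq_trans (count_belowU _ _ _); apply: le_count_below.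
  move=> a [Aa /= as_].
  case: (ltgtP (frac_part (x * a%:R)) s) => h; [by left | | ].
    have [|t _ ft] := fsurj (frac_part (x * a%:R)); first by exists a.
    have := eP t; rewrite ft => /(_ h); rewrite leNgt => /negP[].
    by apply: lt_le_trans as_ _; rewrite lerD2l ge_min lexx.
  by right; rewrite h addrK lexx ltrDl.
by nia.
Qed.

Lemma sparse_density0 (R : realType) (A : set nat) :
  (forall M : nat, exists C : nat, forall n, (M * count_below A n <= n + C)%N) ->
  has_natural_density A (0 : R).
Proof.
move=> sparse; apply/cvgr0Pnorm_lt => e e0.
(* For [n >= C] the sparsity bound reads [M * count_below A n <= 2 n], hence the 2. *)
have [M [M0 Me]] : exists M : nat, 0 < M%:R :> R /\ 2 < M%:R * e.
  by exists (Num.truncn (2 / e)).+1; rewrite -ltr_pdivrMr // truncnS_gt ltr0n.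
have [C hC] := sparse M.
near=> n.
have n0 : (0 < n)%N by near: n; exact: nbhs_infty_gt.
have nC : (C <= n)%N by near: n; exact: nbhs_infty_ge.
rewrite ger0_norm ?divr_ge0 // ltr_pdivrMr ?ltr0n //.
have : (M * count_below A n)%:R <= (n + n)%:R :> R.
  by rewrite ler_nat; apply: leq_trans (hC n) _; rewrite leq_add2l.
have n0R : 0 < n%:R :> R by rewrite ltr0n.
rewrite natrM natrD -(ltr_pM2l M0) => hM.
have : 2 * n%:R < M%:R * e * n%:R by rewrite ltr_pM2r.
move: n%:R (count_below _ _)%:R hM => n' c; lra.
Unshelve. all: by end_near. Qed.

Lemma little_o_linear (R : realType) (Theta : nat -> nat) :
  (Theta n)%:R / n%:R @[n --> \oo] --> (0 : R) ->
  forall L N, (0 < L)%N -> exists n, (N <= n)%N /\ (Theta n < n %/ L)%N.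
Proof.
move=> /cvgr0Pnorm_lt h L N L0.
have L0R : 0 < L%:R :> R by rewrite ltr0n.
(* The factor 2 absorbs the rounding in [n %/ L]: it gives [L * (Theta n + 1) <= n] when
   [Theta n > 0], and [n >= L] covers [Theta n = 0]. *)
have e0 : 0 < (2 * L%:R)^-1 :> R by rewrite invr_gt0 mulr_gt0.
have [M _ MP] := h _ e0.
pose n := (M + N + L)%N; exists n; split; first by rewrite /n; lia.
have := MP n; rewrite /= ger0_norm ?divr_ge0 // => /(_ ltac:(rewrite /n; lia)).
have n0 : (0 < n)%N by rewrite /n; lia.
rewrite ltr_pdivrMr ?ltr0n // mulrC ltr_pdivlMr ?mulr_gt0 //.
rewrite -!natrM ltr_nat leq_divRL //.
have : (L <= n)%N by rewrite /n; lia.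
by case: (Theta n) => [|t]; nia.
Qed.

(** * Finite patterns in a countable linear order *)

Lemma order_gap (R : realType) (r : rel nat) (s : seq (R * nat)) (m : nat) :
  wochoice.total_order r -> {in s, forall p, 0 < p.1 < 1} ->
  {in s &, forall p q, (p.1 <= q.1) = r p.2 q.2} ->
  m \notin [seq p.2 | p <- s] ->
  exists lo hi, [/\ 0 <= lo, lo < hi, hi <= 1 &
    {in s, forall p, if r p.2 m then p.1 <= lo else hi <= p.1}].
Proof.
move=> [[[_ rT] rA] rtot] s01 sr ms.
(* The gap runs from the largest value labelled below [m] to the smallest labelled above it, with
   defaults 0 and 1; the strict bounds on the values keep it nonempty. *)
exists (\big[Num.max/0]_(p <- s | r p.2 m) p.1).
exists (\big[Num.min/1]_(p <- s | ~~ r p.2 m) p.1).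
split.
- exact: bigmax_ge_id.
- rewrite big_seq_cond [X in _ < X]big_seq_cond.
  apply: bigmax_lt => [|p /andP[ps rp]].
    by apply: lt_bigmin => // q /andP[/s01/andP[]].
  apply: lt_bigmin => [|q /andP[qs rq]]; first by case/andP: (s01 _ ps).
  rewrite ltNge sr //; apply: contra rq => rqp.
  exact: rT rqp rp.
- exact: bigmin_le_id.
- move=> p ps; case: ifPn => rp; first exact: le_bigmax_seq.
  exact: ge_bigmin_seq.
Qed.

(** Pigeonhole: each [n] outside [s] has one of finitely many patterns of comparison with [s], so
    infinitely many share one. Dense batches take their labels there. *)
Lemma infinite_cut (r : rel nat) (s : seq nat) : exists m : nat,
  m \notin s /\ infinite_set [set n : nat | n \notin s /\ {in s, forall p, r p n = r p m}].
Proof.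
apply: contrapT => none; apply: infinite_nat.
pose sig n : {ffun 'I_(size s) -> bool} := [ffun j : 'I__ => r (nth 0%N s j) n].
pose fiber c := [set n | n \notin s /\ sig n = c].
apply: (@sub_finite_set _ _ ([set` s] `|` \bigcup_(c in setT) fiber c)).
  move=> n _; have [ns|ns] := boolP (n \in s); first by left.
  by right; exists (sig n).
rewrite finite_setU; split; first exact: finite_seq.
apply: bigcup_finite => [|c _]; first exact: finite_finset.
have [[m [ms mc]]|empty] := pselect (exists m, fiber c m); last first.
  by apply: (@sub_finite_set _ _ set0) => // n fn; apply: empty; exists n.
apply: contrapT => inf; apply: none; exists m; split=> // fin; apply: inf.
apply: sub_finite_set fin => n [ns nc]; split=> // p ps.
have pn : (index p s < size s)%N by rewrite index_mem.
move: mc; rewrite -nc => /ffunP/(_ (Ordinal pn)); rewrite !ffunE /=.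
by rewrite nth_index.
Qed.

(** Sort at least [size H] elements of [F] by [r] and send [a] to the one whose index is the number
    of entries [b] of [H] with [z b < z a]; equal values get equal labels. *)
Lemma monotone_assignment (R : realType) (r : rel nat) (z : nat -> R)
    (H : seq nat) (F : set nat) : wochoice.total_order r -> infinite_set F ->
  exists g : nat -> nat, {in H, forall a, F (g a)} /\
    {in H &, forall a b, (z a <= z b) = r (g a) (g b)}.
Proof.
move=> [[[rR rT] rA] rtot] infF.
have [B BF Bsize] := infinite_set_fset (size H) infF.
pose u := sort r (enum_fset B).
have usize : (size H <= size u)%N by rewrite size_sort.
have usorted : sorted r u by apply: sort_sorted.
have uuniq : uniq u by rewrite sort_uniq fset_uniq.
pose rank a := count (fun b => z b < z a) H.
have rank_lt a : a \in H -> (rank a < size u)%N.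
  move=> aH; apply: leq_trans usize; rewrite -(count_predC (fun b => z b < z a) H).
  rewrite -[X in (X < _)%N]addn0 ltn_add2l -has_count.
  by apply/hasP; exists a => //=; rewrite ltxx.
exists (fun a => nth 0%N u (rank a)); split.
  move=> a aH; apply: BF => /=.
  by rewrite -(mem_sort r) mem_nth // rank_lt.
move=> a b aH bH; have [ab|ba] := leP (z a) (z b).
  apply/esym/(sorted_leq_nth rT rR) => //; rewrite ?inE ?rank_lt //.
  by apply: sub_count => c /= ca; apply: lt_le_trans ab.
have rk : (rank b < rank a)%N.
  have bH' : (0 < count (pred1 b) H)%N by rewrite -has_count has_pred1.
  apply: leq_trans (sub_count (_ : subpred (predU (fun c => z c < z b) (pred1 b))
    _) H); last by move=> c /= /orP[cb|/eqP->//]; apply: lt_trans ba.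
  rewrite -[X in (_ <= X)%N]addn0.
  have <- : count (predI (fun c => z c < z b) (pred1 b)) H = 0%N.
    rewrite (@eq_count _ _ pred0) ?count_pred0 // => c /=.
    by have [->|] := eqVneq c b; rewrite ?ltxx ?andbF.
  by rewrite count_predUI -addn1 leq_add2l.
apply/esym/negbTE/negP => rab.
have rba := sorted_ltn_nth rT 0%N usorted _ _ (rank_lt _ bH) (rank_lt _ aH) rk.
have /eqP := rA _ _ (introT andP (conj rab rba)).
by rewrite nth_uniq ?rank_lt // gtn_eqF.
Qed.

(** * Finite stages and their extension *)

Notation point k := (nat * {ffun 'I_k -> nat})%type (only parsing).

(* A stage of the construction is a finite list of pairs (a, t), recording the
   decision to put a into A with x_i a mod 1 playing the role of the t_i-th
   element of alpha_i for every i. *)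
Definition consistent (R : realType) (k : nat) (y : 'I_k -> nat -> R)
    (r : 'I_k -> rel nat) (S : seq (point k)) : Prop :=
  {in S, forall (p : point k) i, 0 < y i p.1} /\
  {in S &, forall (p q : point k) i, (y i p.1 <= y i q.1) = r i (p.2 i) (q.2 i)}.

Definition labels (k : nat) (S : seq (point k)) (i : 'I_k) :
  seq nat := [seq p.2 i | p : point k <- S].

Definition carrier (k : nat) (S : seq (point k)) : seq nat :=
  [seq p.1 | p : point k <- S].

(** This property and [y i a < 1] are all that the extension steps use of the fractional parts. *)
Definition syndetic (R : realType) (k : nat) (y : 'I_k -> nat -> R) : Prop :=
  forall lo hi : 'I_k -> R,
    (forall i, [/\ 0 <= lo i, lo i < hi i & hi i <= 1]) ->
  exists L : nat, (0 < L)%N /\ forall N, exists a, (N <= a < N + L)%N /\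
    forall i, lo i < y i a < hi i.

(** New labels that compare with the old ones as [m i] does, and values inside the gap reserved for
    [m i], make every comparison of old with new automatic. The batch [E] may hold one point or
    many. *)
Lemma consistent_extend (R : realType) (k : nat) (y : 'I_k -> nat -> R)
    (r : 'I_k -> rel nat) (S : seq (point k)) (m : 'I_k -> nat) :
  (forall i, wochoice.total_order (r i)) -> (forall i a, y i a < 1) ->
  consistent y r S -> (forall i, m i \notin labels S i) ->
  exists lo hi : 'I_k -> R,
    (forall i, [/\ 0 <= lo i, lo i < hi i & hi i <= 1]) /\
    forall E, {in E &, forall (p q : point k) i, (y i p.1 <= y i q.1) = r i (p.2 i) (q.2 i)} ->
      {in E, forall (p : point k) i, lo i < y i p.1 < hi i} ->
      {in E, forall (p : point k) i, p.2 i \notin labels S i /\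
        {in labels S i, forall n, r i n (p.2 i) = r i n (m i)}} ->
      consistent y r (S ++ E).
Proof.
move=> tot y1 [Spos Sr] mS.
have gap i : exists b : R * R, [/\ 0 <= b.1, b.1 < b.2, b.2 <= 1 &
    {in S, forall p : point k, if r i (p.2 i) (m i) then y i p.1 <= b.1 else b.2 <= y i p.1}].
  have [|||lo [hi [lo0 lohi hi1 H]]] := order_gap (s := [seq (y i p.1, p.2 i) | p : point k <- S])
      (m := m i) (tot i).
  - by move=> _ /mapP[p pS ->] /=; rewrite y1 Spos.
  - by move=> _ _ /mapP[p pS ->] /mapP[q qS ->] /=; apply: Sr.
  - by rewrite -map_comp; exact: mS.
  exists (lo, hi); split=> // p pS.
  by apply: (H (y i p.1, p.2 i)); apply/mapP; exists p.
have [b bP] := choice gap.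
exists (fun i => (b i).1), (fun i => (b i).2); split.
  by move=> i; have [] := bP i.
move=> E Er Ebox Elab.
have cross p q i : p \in S -> q \in E ->
    (y i p.1 <= y i q.1) = r i (p.2 i) (q.2 i) /\
    (y i q.1 <= y i p.1) = r i (q.2 i) (p.2 i).
  move=> pS qE; have [[[rR rT] rA] rtot] := tot i.
  have [_ _ _ /(_ p pS)] := bP i.
  have [qlab /(_ (p.2 i))] := Elab q qE i.
  have pl : p.2 i \in labels S i by apply/mapP; exists p.
  have pq : p.2 i <> q.2 i by move=> h; rewrite -h pl in qlab.
  have /andP[lo hi] := Ebox q qE i.
  move=> /(_ pl) <-; case: ifPn => rpq hp; split; apply/esym.
  - by apply/esym/ltW/(le_lt_trans hp).
  - rewrite leNgt (le_lt_trans hp) //=; apply/negbTE/negP => rqp.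
    by apply: pq; apply: rA; rewrite rpq.
  - by rewrite leNgt (lt_le_trans hi) //=; apply/negbTE.
  - rewrite ltW ?(lt_le_trans hi) //.
    by case/orP: (rtot (p.2 i) (q.2 i)) rpq => [->|->].
split.
  move=> p; rewrite mem_cat => /orP[pS|pE] i; first exact: Spos.
  have [lo0 _ _ _] := bP i; have /andP[+ _] := Ebox p pE i.
  exact: le_lt_trans.
move=> p q; rewrite !mem_cat => /orP[pS|pE] /orP[qS|qE] i.
- exact: Sr.
- by have [] := cross p q i pS qE.
- by have [] := cross q p i qS pE.
- exact: Er.
Qed.

Lemma fresh_label (s : seq nat) (n : nat) : exists m, m \notin s /\
  (n \in s \/ m = n).
Proof.
have [ns|ns] := boolP (n \in s); last by exists n; split=> //; right.
exists (\max_(i <- s) i).+1; split; last by left.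
apply/negP => h; suff : ((\max_(i <- s) i).+1 <= \max_(i <- s) i)%N.
  by rewrite ltnn.
exact: (leq_bigmax_seq _ h).
Qed.

Lemma extend_one (R : realType) (k : nat) (y : 'I_k -> nat -> R)
    (r : 'I_k -> rel nat) (S : seq (point k)) (n N : nat) :
  (forall i, wochoice.total_order (r i)) -> (forall i a, y i a < 1) ->
  syndetic y -> consistent y r S ->
  exists p, [/\ (N <= p.1)%N, consistent y r (S ++ [:: p]) &
    forall i, n \in labels (S ++ [:: p]) i].
Proof.
move=> tot y1 syn Scons.
have [m mP] := choice (fun i => fresh_label (labels S i) n).
have [lo [hi [box ext]]] := consistent_extend tot y1 Scons (fun i => (mP i).1).
have [L [_ /(_ N)[a [/andP[aN _] abox]]]] := syn _ _ box.
exists (a, [ffun i => m i]); split=> //.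
- apply: ext.
  + move=> p q; rewrite !inE => /eqP-> /eqP-> i; rewrite lexx.
    by have [[[-> _] _] _] := tot i.
  + by move=> p; rewrite inE => /eqP-> i.
  + move=> p; rewrite inE => /eqP-> i /=; rewrite ffunE; split=> //.
    by have [] := mP i.
- move=> i; rewrite /labels map_cat mem_cat.
  have [_ [->//|<-]] := mP i.
  by rewrite /= ffunE inE eqxx orbT.
Qed.

Lemma extend_many (R : realType) (k : nat) (y : 'I_k -> nat -> R)
    (r : 'I_k -> rel nat) (S : seq (point k))
    (Theta : nat -> nat) (N : nat) :
  (forall i, wochoice.total_order (r i)) -> (forall i a, y i a < 1) ->
  syndetic y -> consistent y r S ->
  (forall L N, (0 < L)%N -> exists n, (N <= n)%N /\ (Theta n < n %/ L)%N) ->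
  exists E, consistent y r (S ++ E) /\ exists n, (N <= n)%N /\
    (Theta n < count_below [set` carrier (S ++ E)] n)%N.
Proof.
move=> tot y1 syn Scons small.
have [m mP] := choice (fun i => infinite_cut (r i) (labels S i)).
have [lo [hi [box ext]]] := consistent_extend tot y1 Scons (fun i => (mP i).1).
have [L [L0 hits]] := syn _ _ box.
have [n [nN nL]] := small L N L0.
pose hit a := [forall i, lo i < y i a < hi i].
pose H := [seq a <- iota 0 n | hit a].
have [g gP] := choice (fun i => monotone_assignment (y i) H (tot i) (mP i).2).
exists [seq (a, [ffun i => g i a]) | a <- H]; split.
  apply: ext.
  - move=> _ _ /mapP[a aH ->] /mapP[b bH ->] i /=; rewrite !ffunE.
    by have [_ ->] := gP i.
  - move=> _ /mapP[a + ->] i /=.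
    by rewrite mem_filter => /andP[/forallP/(_ i)].
  - move=> _ /mapP[a aH ->] i /=; rewrite ffunE.
    by have [/(_ a aH)] := gP i.
exists n; split=> //; apply: leq_trans nL _.
(* One hit in each block [[j L, (j + 1) L)] with [j < n %/ L]; the blocks are disjoint. *)
have [h hP] := choice (fun j => hits (j * L)%N).
rewrite -(size_iota 0 (n %/ L)) -(size_map h) count_belowE -size_filter.
apply: uniq_leq_size.
  rewrite map_inj_uniq ?iota_uniq // => i j hij.
  have [/andP[i1 i2] _] := hP i; have [/andP[j1 j2] _] := hP j.
  by rewrite hij in i1 i2; case: (ltngtP i j) => // ?; nia.
move=> _ /mapP[j + ->]; rewrite mem_iota add0n /= => jn.
have [/andP[_ hj] hbox] := hP j.
have hn : (h j < n)%N.
  apply: leq_trans hj _; rewrite addnC -mulSn.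
  by apply: leq_trans (leq_mul jn (leqnn L)) (leq_divM _ _).
rewrite mem_filter mem_iota hn !andbT; apply/asboolP => /=.
rewrite /carrier map_cat mem_cat -map_comp map_id_in //.
by rewrite mem_filter mem_iota hn !andbT; apply/orP; right; apply/forallP.
Qed.

(** * Limits of the stages *)

Lemma stage_sequence (T : eqType) (Inv : seq T -> Prop)
    (Q : nat -> seq T -> Prop) : Inv [::] ->
  (forall n S, Inv S -> exists E, Inv (S ++ E) /\ Q n (S ++ E)) ->
  exists St : nat -> seq T, [/\ forall n, Inv (St n),
    forall n, Q n (St n.+1) &
    forall m n, (m <= n)%N -> {subset St m <= St n}].
Proof.
move=> Inv0 step.
have step' (p : nat * {S | Inv S}) :
    exists S' : {S | Inv S}, {subset sval p.2 <= sval S'} /\ Q p.1 (sval S').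
  case: p => n [S IS]; have [E [IE QE]] := step n S IS.
  by exists (exist _ _ IE); split=> //= a aS; rewrite mem_cat aS.
have [g gP] := choice step'.
pose St := fix St n := if n is n'.+1 then g (n', St n') else exist _ _ Inv0.
exists (fun n => sval (St n)); split=> [n|n|m n].
- exact: svalP.
- exact: (gP (n, St n)).2.
elim: n => [|n IH]; first by rewrite leqn0 => /eqP ->.
rewrite leq_eqVlt => /predU1P[-> //|/IH sub] a /sub.
exact: (gP (n, St n)).1.
Qed.

(** In the union, fractional parts compare as their labels do, so points with equal labels have
    equal fractional parts, and any choice of a point for each label gives the isomorphism. *)
Lemma limit_order_type (R : realType) (k : nat) (x : 'I_k -> R)
    (d : 'I_k -> Order.disp_t) (alpha : forall i, orderType (d i))
    (e : forall i, nat -> alpha i) (St : nat -> seq (point k)) :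
  (forall i, set_bij [set: nat] [set: alpha i] (e i)) ->
  (forall n, consistent (fun i a => frac_part (x i * a%:R))
    (fun i m n => (e i m <= e i n)%O) (St n)) ->
  (forall m n, (m <= n)%N -> {subset St m <= St n}) ->
  (forall i n, exists N, n \in labels (St N) i) ->
  forall i, has_order_type
    (star (x i) [set a | exists n, a \in carrier (St n)]) (alpha i).
Proof.
move=> ebij Scons Smono cover i.
have total_cons p q m n : p \in St m -> q \in St n ->
    (frac_part (x i * p.1%:R) <= frac_part (x i * q.1%:R)) =
    (e i (p.2 i) <= e i (q.2 i))%O.
  move=> pm qn; apply: (Scons (maxn m n)).2.
    exact: Smono (leq_maxl _ _) _ pm.
  exact: Smono (leq_maxr _ _) _ qn.
have lab (t : alpha i) : exists p : point k,
    (exists n, p \in St n) /\ e i (p.2 i) = t.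
  have [_ _ /(_ t I)[n _ nt]] := ebij i.
  have [N /mapP[p pN np]] := cover i n.
  by exists p; split; [exists N | rewrite -np].
have [G GP] := choice lab.
have Gle s t : (frac_part (x i * (G s).1%:R) <= frac_part (x i * (G t).1%:R)) =
    (s <= t)%O.
  have [[m sm] se] := GP s; have [[n tn] te] := GP t.
  by rewrite (total_cons _ _ _ _ sm tn) se te.
exists (fun t => frac_part (x i * (G t).1%:R)); split=> //; split.
- move=> t _; exists (G t).1 => //=.
  have [[n tn] _] := GP t; exists n; exact: map_f.
- move=> s t _ _ st; apply/eqP.
  by rewrite eq_le -!Gle st lexx.
- move=> _ [a [n /mapP[p pn ->]] <-]; exists (e i (p.2 i)) => //.
  have [[m Gm] Ge] := GP (e i (p.2 i)).
  apply/eqP; rewrite eq_le (total_cons _ _ _ _ Gm pn) Ge lexx.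
  by rewrite (total_cons _ _ _ _ pn Gm) Ge lexx.
Qed.

(** Only finitely many elements lie below [n], so a single stage contains them all; bounds on the
    stages thus pass to the limit. *)
Lemma count_below_stages (k : nat) (St : nat -> seq (point k)) (n : nat) :
  (forall a b, (a <= b)%N -> {subset St a <= St b}) ->
  exists N, (count_below [set a | exists m, a \in carrier (St m)] n <=
    count (fun a => a < n)%N (carrier (St N)))%N.
Proof.
move=> mono; set A := [set a | _].
have [N NP] : exists N, forall a, (a < n)%N -> A a -> a \in carrier (St N).
  elim: n => [|n [N NP]]; first by exists 0%N.
  have [[M nM]|none] := pselect (A n); last first.
    by exists N => a; rewrite ltnS leq_eqVlt => /predU1P[-> //|/NP].
  exists (maxn M N) => a; rewrite ltnS leq_eqVlt => /predU1P[-> _|an Aa].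
    by case/mapP: nM => p pM ->; apply: map_f; apply: mono (leq_maxl _ _) _ pM.
  case/mapP: (NP a an Aa) => p pN ->; apply: map_f.
  exact: mono (leq_maxr _ _) _ pN.
exists N; rewrite count_belowE -!size_filter; apply: uniq_leq_size.
  by rewrite filter_uniq ?iota_uniq.
move=> a; rewrite !mem_filter mem_iota add0n /= => /andP[/asboolP Aa an].
by rewrite an NP.
Qed.

(** [Inv] is kept by every stage and serves sparsity; [Q n] is a task completed by step [n] and
    serves occasional density. Label [n] is also placed at step [n], so that each order is
    exhausted. *)
Lemma exists_with_order_types (R : realType) (k : nat) (x : 'I_k -> R)
    (d : 'I_k -> Order.disp_t) (alpha : forall i, orderType (d i))
    (e : forall i, nat -> alpha i)
    (Inv : seq (point k) -> Prop) (Q : nat -> seq (point k) -> Prop) :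
  let y i a := frac_part (x i * a%:R) in
  let r i m n := (e i m <= e i n)%O in
  (forall i, set_bij [set: nat] [set: alpha i] (e i)) -> int_indep x ->
  Inv [::] ->
  (forall n S, consistent y r S -> Inv S -> exists E, [/\ consistent y r (S ++ E),
     Inv (S ++ E), Q n (S ++ E) & forall i, n \in labels (S ++ E) i]) ->
  exists St : nat -> seq (point k),
    [/\ forall n, Inv (St n), forall n, Q n (St n.+1),
        forall a b, (a <= b)%N -> {subset St a <= St b} &
        forall i, has_order_type
          (star (x i) [set a | exists m, a \in carrier (St m)]) (alpha i)].
Proof.
move=> y r ebij indx Inv0 step.
have [||St [StI StQ Stmono]] := @stage_sequence (point k : eqType)
  (fun S => consistent y r S /\ Inv S)
  (fun n S => Q n S /\ forall i, n \in labels S i).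
- by split=> //; split.
- move=> n S [Sc SI]; have [E [Ec EI EQ El]] := step n S Sc SI.
  by exists E.
exists St; split=> //.
- by move=> n; have [] := StI n.
- by move=> n; have [] := StQ n.
- apply: (limit_order_type ebij) => //.
  + by move=> n; have [] := StI n.
  + by move=> i n; exists n.+1; have [_] := StQ n; apply.
Qed.

(** * Enumeration of the order types and the three assertions *)

Lemma countably_infinite_enum (T : Type) : ([set: T] #= [set: nat])%card ->
  exists e : nat -> T, set_bij [set: nat] [set: T] e.
Proof.
move=> /card_set_bijP[f [_ finj fsurj]].
have [e eP] : {e : nat -> T & forall n, f (e n) = n}.
  apply: (choice (P := fun n t => f t = n)) => n.
  by have [t _ ft] := fsurj n Logic.I; exists t.
exists e; split=> // [m n _ _ mn|t _]; first by rewrite -(eP m) mn eP.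
by exists (f t) => //; apply: finj; rewrite ?inE // eP.
Qed.

Lemma unbounded_infinite_set (A : set nat) :
  (forall N, exists n, (N <= n)%N /\ A n) -> infinite_set A.
Proof.
move=> unb /finite_seqP[s As].
have [n [sn An]] := unb (\max_(i <- s) i).+1.
have ns : n \in s by have : [set` s] n by rewrite -As.
suff : (n < n)%N by rewrite ltnn.
exact: leq_ltn_trans (leq_bigmax_seq _ ns _) sn.
Qed.

Theorem theorem1 (R : realType) (k : nat) (hk : (1 <= k)%N)
    (d : 'I_k -> Order.disp_t) (alpha : forall i : 'I_k, orderType (d i))
    (alpha_countably_infinite :
      forall i : 'I_k, ([set: alpha i] #= [set: nat])%card)
    (x : 'I_k -> R)
    (x_irrational : forall i : 'I_k, irrational (x i))
    (* oapp x 1 is the family 1, x_0, ..., x_(k-1), with 1 at index None *)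
    (x_indep : lin_indep_rat (oapp x 1)) :
  [/\ exists A : set nat,
        forall i : 'I_k, has_order_type (star (x i) A) (alpha i),
      forall Psi : nat -> nat, Psi n @[n --> \oo] --> \oo ->
        exists A : set nat,
          (forall i : 'I_k, has_order_type (star (x i) A) (alpha i)) /\
          (forall n : nat, (count_below A n <= Psi n)%N)
    & (forall i : 'I_k, wochoice.well_order (<=%O : rel (alpha i))) ->
        (forall A : set nat,
          (forall i : 'I_k, has_order_type (star (x i) A) (alpha i)) ->
          has_natural_density A (0 : R)) /\
        (forall Theta : nat -> nat,
          (Theta n)%:R / n%:R @[n --> \oo] --> (0 : R) ->
          exists A : set nat,
            (forall i : 'I_k, has_order_type (star (x i) A) (alpha i)) /\
            infinite_set [set n : nat | (Theta n < count_below A n)%N])].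
Proof.
have indx := lin_indep_rat_int x_indep.
pose e i := sval (cid (countably_infinite_enum (alpha_countably_infinite i))).
have ebij i : set_bij [set: nat] [set: alpha i] (e i).
  exact: svalP (cid (countably_infinite_enum (alpha_countably_infinite i))).
pose y i a := frac_part (x i * a%:R).
pose r i m n := (e i m <= e i n)%O.
have y1 i a : y i a < 1 by exact: frac_part_lt1.
have syn : syndetic y by move=> lo hi; exact: syndetic_hits.
have tot i : wochoice.total_order (r i).
  split; first split; first split.
  - by move=> m; exact: lexx.
  - by move=> m n p; exact: le_trans.
  - move=> m n /le_anti h; have [_ inj _] := ebij i.
    by apply: inj h; rewrite inE.
  - by move=> m n; exact: le_total.
have sparse (Psi : nat -> nat) : Psi n @[n --> \oo] --> \oo ->
    exists A : set nat,
      (forall i : 'I_k, has_order_type (star (x i) A) (alpha i)) /\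
      (forall n : nat, (count_below A n <= Psi n)%N).
  move=> /cvgnyPge Psioo.
  have [||St [StI _ Stmono Sttype]] := exists_with_order_types
    (Inv := fun S => forall n, (count (fun a => a < n)%N (carrier S) <= Psi n)%N)
    (Q := fun _ _ => True) ebij indx; first by [].
    (* From [N] on, [Psi] is at least [size S + 1]; a new point at or after [N] leaves the counts up
       to it unchanged. *)
    move=> n S Sc SPsi; have [N _ NP] := Psioo (size S).+1.
    have [p [pN Sp pl]] := extend_one n N tot y1 syn Sc.
    exists [:: p]; split=> // m; rewrite /carrier map_cat count_cat /= addn0.
    have [pm|mp] := ltnP; last by rewrite addn0.
    rewrite addn1; apply: leq_trans (NP m _).
      by rewrite ltnS -(size_map fst S) count_size.
    exact: leq_trans pN (ltnW pm).
  exists [set a | exists m, a \in carrier (St m)]; split=> // n.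
  have [N hN] := count_below_stages n Stmono.
  exact: leq_trans hN (StI N n).
split=> //.
  (* The first assertion is the sparse one with the identity for [Psi]. *)
  by have [|A [Atype _]] := sparse id; [exact: cvg_id | exists A].
move=> wo; split=> [A Atype | Theta /little_o_linear small].
  apply: sparse_density0.
  exact: (well_ordered_star_sparse (x_irrational (Ordinal hk)) (Atype _) (wo _)).
have [||St [_ StQ _ Sttype]] := exists_with_order_types
  (Inv := fun=> True)
  (Q := fun N S => exists n, (N <= n)%N /\
    (Theta n < count_below [set` carrier S] n)%N) ebij indx; first by [].
  (* Step [n] places the label [n] and then a batch that beats [Theta] at some index at least [n],
     so such indices are unbounded. *)
  move=> n S Sc _; have [p [_ Sp pl]] := extend_one n 0 tot y1 syn Sc.
  have [E [SE En]] := extend_many n tot y1 syn Sp small.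
  exists (p :: E); rewrite -cat1s catA; split=> // i.
  by rewrite /labels map_cat mem_cat -/(labels _ _) pl.
exists [set a | exists m, a \in carrier (St m)]; split=> //.
apply: unbounded_infinite_set => N; have [n [Nn hn]] := StQ N.
exists n; split=> //=; apply: leq_trans hn _.
by apply: le_count_below => a /= aS; exists N.+1.
Qed.
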